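(* Let $n\ge 3$ and $k\in\{2,\ldots,n-1\}$, and let $T^{k,n}$ be the problem instance defined in the context. Let $N^a$ be any output of Algorithm 1 on input $T^{k,n}$, i.e., a CPT such that, writing $T^{k,n}=(N_1,\ldots,N_t)$ and letting, for each $s$, $N^*_s$ be a CPT minimizing $f_{T^{k,n}}$ among all CPTs for $V_n$ whose parent set is contained in $Pa(N_s,V_n)$, we have $N^a=N^*_{s^*}$ for some $s^*$ with $f_{T^{k,n}}(N^*_{s^*})=\min_{1\le s\le t}f_{T^{k,n}}(N^*_s)$. Then $N^a$ is an optimal solution for $T^{k,n}$.
   Context: Binary attributes $V_1,\ldots,V_n$, each with domain $\{0,1\}$. For $Q\subseteq\{V_1,\ldots,V_{n-1}\}$, $\mathrm{Inst}(Q)$ is the set of assignments of values in $\{0,1\}$ to the attributes of $Q$ (contexts). A (complete) CPT $N$ for $V_n$ consists of a parent set $Pa(N,V_n)\subseteq\{V_1,\ldots,V_{n-1}\}$ and, for each $\gamma\in\mathrm{Inst}(Pa(N,V_n))$, exactly one rule, either $\gamma:0\succ 1$ or $\gamma:1\succ 0$. A swap over $V_n$ is identified with an element $x\in\{0,1\}^{n-1}$; the vote of $N$ on $x$ is $0$ if the rule of $N$ whose context agrees with $x$ on $Pa(N,V_n)$ is of the form $\gamma:0\succ1$, and $1$ otherwise. $\Delta(N,N')$ is the number of swaps on which $N,N'$ vote differently. For a problem instance $T=(N_1,\ldots,N_t)$ (tuple of CPTs for $V_n$), $f_T(N)=\sum_{s=1}^t\Delta(N,N_s)$; an optimal solution for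 $T$ is a CPT for $V_n$ (any parent set $\subseteq\{V_1,\ldots,V_{n-1}\}$) minimizing $f_T$. The instance $T^{k,n}=(N_1,\ldots,N_t)$, for $n\ge3$, $k\in\{2,\ldots,n-1\}$, has $t=\binom{n-1}{k}2^k$, with the indices $s$ in bijection with the pairs $(P,\gamma)$ where $P$ is a $k$-element subset of $\{V_1,\ldots,V_{n-1}\}$ and $\gamma\in\mathrm{Inst}(P)$; the CPT $N_s$ corresponding to $(P,\gamma)$ has parent set $P$, the rule $\gamma:1\succ0$, and the rule $\gamma':0\succ1$ for every $\gamma'\in\mathrm{Inst}(P)\setminus\{\gamma\}$. *)

(* Defs.v *)
From HB Require Import structures.
From mathcomp Require Import all_boot.

Set Implicit Arguments.
Unset Strict Implicit.
Unset Printing Implicit Defensive.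

(* The attributes V_1, ..., V_(n-1) are the elements of 'I_n.-1, and the      *)
(* domain {0,1} is bool, with false = 0 and true = 1.                         *)

Definition Inst (n : nat) (Q : {set 'I_n.-1}) : finType :=
  {ffun {i : 'I_n.-1 | i \in Q} -> bool}.

Definition swap (n : nat) : finType := {ffun 'I_n.-1 -> bool}.

(* rule N g is the preferred value of V_n in context g: false encodes the     *)
(* rule g : 0 > 1 and true the rule g : 1 > 0. A parent need not influence    *)
(* the preference.                                                            *)
Record cpt (n : nat) := CPT {
  Pa : {set 'I_n.-1};
  rule : {ffun Inst Pa -> bool}
}.

Definition restr (n : nat) (x : swap n) (Q : {set 'I_n.-1}) : Inst Q :=
  [ffun i : {i : 'I_n.-1 | i \in Q} => x (val i)].

Definition vote (n : nat) (N : cpt n) (x : swap n) : bool :=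
  rule N (restr x (Pa N)).

Definition Delta (n : nat) (N N' : cpt n) : nat :=
  #|[set x : swap n | vote N x != vote N' x]|.

Definition cost (n t : nat) (T : t.-tuple (cpt n)) (N : cpt n) : nat :=
  \sum_(s < t) Delta N (tnth T s).

Definition optimal (n t : nat) (T : t.-tuple (cpt n)) (N : cpt n) : Prop :=
  forall N' : cpt n, cost T N <= cost T N'.

Definition optimal_within (n t : nat) (T : t.-tuple (cpt n))
    (Q : {set 'I_n.-1}) (N : cpt n) : Prop :=
  Pa N \subset Q /\
  forall N' : cpt n, Pa N' \subset Q -> cost T N <= cost T N'.

(* The choice of the restricted minimizers Nstar s and of the index sstar is  *)
(* left free, so that every way of breaking ties is covered.                  *)
Definition algorithm_output (n t : nat) (T : t.-tuple (cpt n))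
    (Na : cpt n) : Prop :=
  exists Nstar : 'I_t -> cpt n,
    (forall s : 'I_t, optimal_within T (Pa (tnth T s)) (Nstar s)) /\
    exists sstar : 'I_t,
      (forall s : 'I_t, cost T (Nstar sstar) <= cost T (Nstar s)) /\
      Na = Nstar sstar.

(* The pairs (P, g) with #|P| = k and g in Inst P.                            *)
Definition kcontext (k n : nat) : finType :=
  {p : {P : {set 'I_n.-1} & Inst P} | #|tag p| == k}.

Definition cpt_of_kcontext (k n : nat) (p : kcontext k n) : cpt n :=
  CPT [ffun g : Inst (tag (val p)) => g == tagged (val p)].

(* Tkn e is the instance T^{k,n} listed in the order given by e, which is     *)
(* meant to be a bijection; card_kcontext shows that one exists.              *)
Definition Tkn (k n : nat)
    (e : 'I_('C(n.-1, k) * 2 ^ k) -> kcontext k n) :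
    ('C(n.-1, k) * 2 ^ k).-tuple (cpt n) :=
  [tuple cpt_of_kcontext (e s) | s < 'C(n.-1, k) * 2 ^ k].

Lemma card_kcontext (k n : nat) : #|kcontext k n| = 'C(n.-1, k) * 2 ^ k.
Proof.
rewrite card_sig -sum1_card.
pose U (P : {set 'I_n.-1}) (_ : Inst P) := 1.
rewrite (eq_bigr (fun p => U (tag p) (tagged p))) //.
rewrite (eq_bigl (fun p : {P : {set 'I_n.-1} & Inst P} =>
  (#|tag p| == k) && true)); last by move=> p; rewrite andbT.
rewrite -(sig_big_dep (fun P : {set 'I_n.-1} => #|P| == k) (fun _ _ => true) U).
rewrite (eq_bigr (fun=> 2 ^ k)) => [|P /eqP cardP]; last first.
  by rewrite sum1_card card_ffun card_bool card_sig cardP.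
by rewrite sum_nat_const -[X in 'C(X, _)]card_ord -card_draws cardsE.
Qed.

(* Main.v *)
Require Import Defs.
From mathcomp Require Import all_boot.

(* On every swap x the voters for 1 are at most as many as the voters for 0:  *)
(* complementing the context g of a pair (P, g) is an involution on voters    *)
(* that turns a vote for 1 on x into a vote for 0, because P is nonempty.     *)
(* Hence the parentless CPT voting 0 everywhere is optimal. Its parent set    *)
(* lies in every Pa N_s, so the algorithm does at least as well.              *)

Set Implicit Arguments.
Unset Strict Implicit.
Unset Printing Implicit Defensive.

(** The cost splits into one term per swap ([cost_swapE]), so following a majority on every swap
    minimizes it ([zero_cpt_optimal]). [kcontext_majority] supplies this majority for 0, and
    [algorithm_output_le] passes optimality on to the output. *)

Definition zero_cpt (n : nat) : cpt n :=
  CPT [ffun _ : Inst (set0 : {set 'I_n.-1}) => false].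

Lemma vote_zero_cpt (n : nat) (x : swap n) : vote (zero_cpt n) x = false.
Proof. by rewrite /vote ffunE. Qed.

Lemma cost_swapE (n t : nat) (T : t.-tuple (cpt n)) (N : cpt n) :
  cost T N = \sum_(x : swap n) \sum_(s < t) (vote N x != vote (tnth T s) x).
Proof.
rewrite exchange_big; apply: eq_bigr => s _.
rewrite /Delta -sum1_card big_mkcond; apply: eq_bigr => x _.
by rewrite inE; case: ifP.
Qed.

Lemma zero_cpt_optimal (n t : nat) (T : t.-tuple (cpt n)) :
  (forall x : swap n,
     \sum_(s < t) vote (tnth T s) x <= \sum_(s < t) ~~ vote (tnth T s) x) ->
  optimal T (zero_cpt n).
Proof.
move=> maj0 N; rewrite !cost_swapE; apply: leq_sum => x _.
rewrite vote_zero_cpt; case: (vote N x) => //.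
under eq_bigr do rewrite eq_sym eqbF_neg negbK.
by under [leqRHS]eq_bigr do rewrite eq_sym eqb_id.
Qed.

(** Such an [N] competes in each restricted minimization, in particular in the one that produced
    [Na]. *)
Lemma algorithm_output_le (n t : nat) (T : t.-tuple (cpt n)) (Na N : cpt n) :
  algorithm_output T Na -> (forall s, Pa N \subset Pa (tnth T s)) ->
  cost T Na <= cost T N.
Proof. by move=> [Nstar [optNstar [s [_ ->]]]] /(_ s) /((optNstar s).2). Qed.

Definition compl_context (n : nat) (q : {P : {set 'I_n.-1} & Inst P}) :
    {P : {set 'I_n.-1} & Inst P} :=
  Tagged (fun P => Inst P)
    ([ffun i => ~~ tagged q i] : Inst (tag q)).

Lemma compl_contextK (n : nat) : involutive (@compl_context n).
Proof.
by case=> P g; congr existT; apply/ffunP => i; rewrite !ffunE negbK.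
Qed.

Definition compl_kcontext (k n : nat) (p : kcontext k n) : kcontext k n :=
  Sub (compl_context (val p)) (valP p).

Lemma compl_kcontextK (k n : nat) : involutive (@compl_kcontext k n).
Proof. by move=> p; apply: val_inj; apply: compl_contextK. Qed.

Lemma vote_kcontext (k n : nat) (p : kcontext k n) (x : swap n) :
  vote (cpt_of_kcontext p) x = (restr x (tag (val p)) == tagged (val p)).
Proof. by rewrite /vote ffunE. Qed.

(** A context and its complement differ at any parent, and [0 < k] provides one, so [x] cannot agree
    with both. *)
Lemma vote_compl_kcontext (k n : nat) (p : kcontext k n) (x : swap n) :
  0 < k -> vote (cpt_of_kcontext (compl_kcontext p)) x ->
  ~~ vote (cpt_of_kcontext p) x.
Proof.
move=> k_gt0; rewrite !vote_kcontext /= => /eqP xE.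
have /card_gt0P[i Pi] : 0 < #|tag (val p)| by rewrite (eqP (valP p)).
apply/eqP => /ffunP/(_ (exist _ i Pi)).
by rewrite xE ffunE; case: (tagged (val p) _).
Qed.

Lemma kcontext_majority (k n : nat) (x : swap n) : 0 < k ->
  \sum_(p : kcontext k n) vote (cpt_of_kcontext p) x <=
  \sum_(p : kcontext k n) ~~ vote (cpt_of_kcontext p) x.
Proof.
move=> k_gt0; rewrite (reindex_inj (inv_inj (@compl_kcontextK k n))) /=.
by apply: leq_sum => p _; case: vote (@vote_compl_kcontext k n p x k_gt0) => // ->.
Qed.

Theorem theorem16 (n k : nat) (hn : 3 <= n) (hk : 2 <= k <= n.-1)
    (e : 'I_('C(n.-1, k) * 2 ^ k) -> kcontext k n) (he : bijective e)
    (Na : cpt n) (hNa : algorithm_output (Tkn e) Na) :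
  optimal (Tkn e) Na.
Proof.
move=> N; have k_gt0 : 0 < k by case/andP: hk => /ltnW.
apply: leq_trans (algorithm_output_le hNa (N := zero_cpt n) _) _ => [s|].
  exact: sub0set.
apply: zero_cpt_optimal => x.
(* Keeping [F] general lets one reindexing along [e] serve both the votes for 1 and the votes for
   0. *)
have sum_e F : \sum_s F (vote (tnth (Tkn e) s) x) =
    \sum_(p : kcontext k n) F (vote (cpt_of_kcontext p) x) :> nat.
  rewrite [RHS](@reindex _ _ _ (kcontext k n) _ e) /=; last exact: onW_bij.
  by apply: eq_bigr => s _; rewrite tnth_mktuple.
by rewrite (sum_e nat_of_bool) (sum_e (fun b => ~~ b)); apply: kcontext_majority.
Qed.
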